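(* Let $(M,F)$ be an $n$-dimensional Finsler manifold whose Berwald curvature satisfies, on $TM_0$, $$B^i_{\ jkl}=(\mu_jh_{kl}+\mu_kh_{jl}+\mu_lh_{jk})y^i+\lambda\big(h^i_j h_{kl}+h^i_k h_{jl}+h^i_l h_{jk}\big),$$ where $\mu_i=\mu_i(x,y)$ and $\lambda=\lambda(x,y)$ are positively homogeneous in $y$ of degrees $-2$ and $-1$ respectively. Then $F$ is a generalized Douglas--Weyl (GDW) metric, i.e. $h^i_{\alpha}D^\alpha_{\ jkl|m}y^m=0$.
   Context: $M$ is an $n$-dimensional $C^\infty$ manifold and $TM_0=TM\setminus\{0\}$ is the slit tangent bundle, with standard local coordinates $(x^i,y^i)$. A Finsler metric $F:TM\to[0,\infty)$ is $C^\infty$ on $TM_0$, positively 1-homogeneous on fibers, and such that $g_{ij}=\frac12\frac{\partial^2 F^2}{\partial y^i\partial y^j}$ is positive definite on $TM_0$. Indices are lowered and raised with $g_{ij}$ and its inverse $g^{ij}$; $y_i=g_{ij}y^j$, $h_{ij}=g_{ij}-F^{-2}y_iy_j$ (angular metric), $h^i_j=\delta^i_j-F^{-2}y^iy_j$. Spray coefficients: $G^i=\frac14 g^{il}\left\{\frac{\partial^2 F^2}{\partial x^k\partial y^l}y^k-\frac{\partial F^2}{\partial x^l}\right\}$. Berwald curvature: $B^i_{\ jkl}=\frac{\partial^3G^i}{\partial y^j\partial y^k\partial y^l}$. Douglas tensor: $D^i_{\ jkl}=\frac{\partial^3}{\partial y^j\partial y^k\partial y^l}\left(G^i-\frac{1}{n+1}\frac{\partial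 G^m}{\partial y^m}y^i\right)$. The symbol $|$ denotes the horizontal covariant derivative of the Berwald connection: for a tensor with components $T^i_{\ j}(x,y)$ on $TM_0$ (and similarly for other types), $T^i_{\ j|m}=\frac{\partial T^i_{\ j}}{\partial x^m}-\frac{\partial G^r}{\partial y^m}\frac{\partial T^i_{\ j}}{\partial y^r}+\frac{\partial^2G^i}{\partial y^r\partial y^m}T^r_{\ j}-\frac{\partial^2G^r}{\partial y^j\partial y^m}T^i_{\ r}$. In the assumed form of the Berwald curvature, $\mu_i$ are the components of a covector field along $TM_0$ and $\lambda$ is a scalar function on $TM_0$; since $B^i_{\ jkl}y^j=0$, one has $\mu_iy^i=0$. *)

(* Defs.v *)
From HB Require Import structures.
From mathcomp Require Import all_boot all_order all_algebra.
From mathcomp Require Import all_classical all_reals all_analysis.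
Set Implicit Arguments.
Unset Strict Implicit.
Unset Printing Implicit Defensive.
Import Order.TTheory GRing.Theory Num.Theory.
Import numFieldNormedType.Exports.
Local Open Scope classical_set_scope.
Local Open Scope ring_scope.

Section Smooth.
Context {R : realType} {V W : normedModType R}.

Definition iterated_derive (vs : seq V) (f : V -> W) : V -> W :=
  foldr (fun v g => fun x => 'D_v g x) f vs.

(* C^oo on A, for V finite dimensional: f and all its iterated (directional)
   derivatives are Frechet differentiable at every point of A. *)
Definition smooth_on (A : set V) (f : V -> W) : Prop :=
  forall vs x, A x -> differentiable (iterated_derive vs f) x.

End Smooth.

(* [chart_inv] is only meaningful on [chart_cod], and [chart_map] on
   [chart_dom]. *)
Record chart (R : realType) (n : nat) (M : topologicalType) := Chart {
  chart_dom : set M ;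
  chart_cod : set 'rV[R]_n ;
  chart_map : M -> 'rV[R]_n ;
  chart_inv : 'rV[R]_n -> M ;
  chart_dom_open : open chart_dom ;
  chart_cod_open : open chart_cod ;
  chart_map_cod : forall p, chart_dom p -> chart_cod (chart_map p) ;
  chart_inv_dom : forall x, chart_cod x -> chart_dom (chart_inv x) ;
  chart_mapK : forall p, chart_dom p -> chart_inv (chart_map p) = p ;
  chart_invK : forall x, chart_cod x -> chart_map (chart_inv x) = x ;
  chart_map_cont : {within chart_dom, continuous chart_map} ;
  chart_inv_cont : {within chart_cod, continuous chart_inv} }.

Section Transition.
Context {R : realType} {n : nat} {M : topologicalType}.
Implicit Types a b : chart R n M.

Definition transition a b : 'rV[R]_n -> 'rV[R]_n := chart_map b \o chart_inv a.

Definition diff_transition a b (x w : 'rV[R]_n) : 'rV[R]_n :=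
  'd (transition a b) x w.

Definition overlap a b : set 'rV[R]_n :=
  [set x | chart_cod a x /\ chart_dom b (chart_inv a x)].

End Transition.

Record manifold (R : realType) (n : nat) := Manifold {
  carrier :> topologicalType ;
  atlas : set (chart R n carrier) ;
  manifold_hausdorff : hausdorff_space carrier ;
  manifold_second_countable : @second_countable carrier ;
  atlas_cover : forall p, exists2 a, atlas a & chart_dom a p ;
  atlas_smooth : forall a b, atlas a -> atlas b ->
    smooth_on (overlap a b) (transition a b) }.

(* TM is the gluing of the sets chart_cod a * R^n along the maps
   (x, y) |-> (transition a b x, d(transition a b)_x y).  A point (x, y) of one
   of these sets lists the standard local coordinates (x^i, y^i), and a function
   on TM is given by its expressions in these coordinates, which must agree
   under [tangent_transition]. *)
Notation coords R n := ('rV[R]_n * 'rV[R]_n)%type.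

Section TangentBundle.
Context {R : realType} {n : nat} {M : manifold R n}.
Implicit Types a b : chart R n M.

Definition TM_chart a : set (coords R n) := [set z | chart_cod a z.1].

Definition TM0_chart a : set (coords R n) :=
  [set z | chart_cod a z.1 /\ z.2 != 0].

Definition tangent_transition a b (z : coords R n) : coords R n :=
  (transition a b z.1, diff_transition a b z.1 z.2).

Definition scalar_on_TM (F : chart R n M -> coords R n -> R) : Prop :=
  forall a b (z : coords R n), atlas a -> atlas b -> overlap a b z.1 ->
    F b (tangent_transition a b z) = F a z.

Definition scalar_on_TM0 (f : chart R n M -> coords R n -> R) : Prop :=
  forall a b (z : coords R n), atlas a -> atlas b -> overlap a b z.1 -> z.2 != 0 ->
    f b (tangent_transition a b z) = f a z.

(* [mu a i] is the i-th component in the chart a; the law states that the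
   linear form w |-> mu_i w^i does not depend on the chart. *)
Definition covector_field_along_TM0
    (mu : chart R n M -> 'I_n -> coords R n -> R) : Prop :=
  forall a b (z : coords R n), atlas a -> atlas b -> overlap a b z.1 -> z.2 != 0 ->
    forall w : 'rV[R]_n,
      \sum_i mu b i (tangent_transition a b z) * (diff_transition a b z.1 w) 0 i
      = \sum_i mu a i z * w 0 i.

End TangentBundle.

(* Positive homogeneity of degree k in y. *)
Definition homogeneous_on (R : realType) (n : nat) (A : set (coords R n))
    (k : int) (f : coords R n -> R) : Prop :=
  forall (z : coords R n) (t : R), A z -> 0 < t -> f (z.1, t *: z.2) = t ^ k * f z.

Section LocalFormulas.
Context {R : realType} {n : nat}.
Implicit Types (f : coords R n -> R) (z : coords R n) (i j k l m r : 'I_n).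

Definition dx i f : coords R n -> R :=
  fun z => 'D_((delta_mx 0 i, 0) : coords R n) f z.

Definition dy i f : coords R n -> R :=
  fun z => 'D_((0, delta_mx 0 i) : coords R n) f z.

(* T i j k l stands for the component T^i_{jkl}; the horizontal derivative
   T^i_{jkl|m} is the one of the Berwald connection of the spray G. *)
Definition hderiv (G : 'I_n -> coords R n -> R)
    (T : 'I_n -> 'I_n -> 'I_n -> 'I_n -> coords R n -> R) i j k l m z : R :=
  dx m (T i j k l) z
  - \sum_r dy m (G r) z * dy r (T i j k l) z
  + \sum_r dy r (dy m (G i)) z * T r j k l z
  - \sum_r dy j (dy m (G r)) z * T i r k l z
  - \sum_r dy k (dy m (G r)) z * T i j r l z
  - \sum_r dy l (dy m (G r)) z * T i j k r z.

(* Below, F is the expression of a Finsler metric in a chart. *)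
Variable F : coords R n -> R.

Definition squared z : R := F z ^+ 2.

Definition metric z : 'M[R]_n := \matrix_(i, j) (2^-1 * dy i (dy j squared) z).

Definition inv_metric z : 'M[R]_n := invmx (metric z).

Definition y_low i z : R := \sum_j metric z i j * z.2 0 j.

Definition angular i j z : R :=
  metric z i j - (F z ^+ 2)^-1 * y_low i z * y_low j z.

(* h^i_j *)
Definition angular_mixed i j z : R :=
  (i == j)%:R - (F z ^+ 2)^-1 * z.2 0 i * y_low j z.

Definition spray i z : R :=
  4^-1 * \sum_l inv_metric z i l *
    (\sum_k dx k (dy l squared) z * z.2 0 k - dx l squared z).

Definition berwald i j k l : coords R n -> R := dy j (dy k (dy l (spray i))).

Definition douglas i j k l : coords R n -> R :=
  dy j (dy k (dy l (fun z =>
    spray i z - (n.+1%:R)^-1 * (\sum_m dy m (spray m) z) * z.2 0 i))).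

End LocalFormulas.

Section Finsler.
Context {R : realType} {n : nat}.
Variable M : manifold R n.
Variable F : chart R n M -> coords R n -> R.

Definition finsler_metric : Prop :=
  scalar_on_TM F /\
  forall a, atlas a ->
    [/\ forall z, TM_chart a z -> 0 <= F a z,
        smooth_on (TM0_chart a) (F a),
        homogeneous_on (TM_chart a) 1 (F a) &
        forall z, TM0_chart a z -> forall w : 'rV[R]_n, w != 0 ->
          0 < \sum_i \sum_j metric (F a) z i j * w 0 i * w 0 j].

Definition GDW : Prop :=
  forall a z, atlas a -> TM0_chart a z -> forall i j k l : 'I_n,
    \sum_r \sum_m angular_mixed (F a) i r z
      * hderiv (spray (F a)) (douglas (F a)) r j k l m z * z.2 0 m = 0.

End Finsler.

(* Main.v *)
(* Tracing the assumed Berwald curvature gives d_k d_l (d_m G^m) = (n+1) lambda h_kl,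
   the term (mu_m y^m) h_kl being zero because B^i_jkl y^j = 0.  Subtracting the
   corresponding terms of the Douglas tensor leaves D^i_jkl = T_jkl y^i.  By Euler's
   relation for the 1-homogeneous functions d_m G^i, the horizontal derivative of
   T_jkl y^i is again a multiple of y^i, and the angular projection h kills y. *)
Require Import Defs.
From HB Require Import structures.
From mathcomp Require Import all_boot all_order all_algebra.
From mathcomp Require Import all_classical all_reals all_analysis.
From mathcomp Require Import ring lra.
Import Order.TTheory GRing.Theory Num.Theory.
Import numFieldNormedType.Exports.
Local Open Scope classical_set_scope.
Local Open Scope ring_scope.
Set Implicit Arguments.
Unset Strict Implicit.
Unset Printing Implicit Defensive.

(** * Directional derivatives and the symmetry of second derivatives *)

Section DirectionalCalculus.
Context {R : realType} {V : normedModType R}.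
Implicit Types (A : set V) (f g : V -> R) (x v : V).

Lemma open_eq_derive A f g x v : open A -> A x -> {in A, f =1 g} ->
  'D_v f x = 'D_v g x.
Proof.
move=> oA Ax fg; apply: near_eq_derive.
by near=> y; apply: fg; rewrite inE; near: y; exact: open_nbhs_nbhs.
Unshelve. all: by end_near. Qed.

(** The first-order expansion of [f] at [x] only involves values near [x], so it is also one for
    [g]; uniqueness of the differential then identifies ['d g x] with ['d f x]. *)
Lemma open_eq_differentiable A f g x : open A -> A x -> {in A, f =1 g} ->
  differentiable f x -> differentiable g x.
Proof.
move=> oA Ax fg df.
have gE : g \o shift x = cst (g x) + 'd f x +o_ 0 id.
  apply/eqaddoP => e e0.
  have := diff_locally df => /eqaddoP /(_ _ e0) fE.
  have : nbhs x A by exact: open_nbhs_nbhs.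
  move=> /(nbhs0P A) nA; apply: filterS2 fE nA => h /= + Ah.
  by rewrite !fctE /= -!fg ?inE // addrC.
have dfc := diff_continuous df.
have dgE := diff_unique dfc gE.
by apply/diff_locallyP; rewrite dgE.
Qed.

Lemma derive_comp_linear (W : normedModType R) (L : {linear W -> V}) f (x v : W) :
  'D_v (f \o L) x = 'D_(L v) f (L x).
Proof.
rewrite /derive (_ : (fun h => _) =
  fun h => h^-1 *: ((f \o shift (L x)) (h *: L v) - f (L x)))//.
by apply/funext => h /=; rewrite (linearD L) linearZZ.
Qed.

Lemma derive_along_line f x v t :
  differentiable f (x + t *: v) ->
  is_derive (t : R) 1 (fun s => f (x + s *: v)) ('D_v f (x + t *: v)).
Proof.
move=> df.
have qE : (fun h : R => h^-1 *: (((fun s => f (x + s *: v)) \o shift t) (h *: 1)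
      - f (x + t *: v))) =
    fun h => h^-1 *: ((f \o shift (x + t *: v)) (h *: v) - f (x + t *: v)).
  apply/funext => h /=; congr (_ *: (f _ - _)).
  by rewrite [h%:A]mulr1 scalerDl addrCA.
by apply: DeriveDef; rewrite /derivable /derive qE//; exact: diff_derivable.
Qed.

(* Mean value theorem applied to s |-> f (x + h v + s u) - f (x + s u) on [0, h]. *)
Lemma second_difference A f x u v (e : R) : open A -> A x ->
  (forall y, A y -> differentiable f y) ->
  differentiable (fun y => 'D_u f y) x -> 0 < e ->
  \forall h \near 0^'+,
    `|f (x + h *: u + h *: v) - f (x + h *: u) - f (x + h *: v) + f x
      - h ^+ 2 * 'D_v (fun y => 'D_u f y) x| <= e * h ^+ 2.
Proof.
move=> oA Ax df dg e0; set g := fun y => 'D_u f y.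
(* Two displacements will occur, s u + h v and s u with 0 <= s <= h; their norms add up to at most h
   (2|u| + |v|) <= h c. The summand 1 makes [c] positive. *)
pose c := 2 * `|u| + `|v| + 1.
have c0 : 0 < c by rewrite /c ltr_wpDl// addr_ge0// mulr_ge0.
have ec0 : 0 < e / c by rewrite divr_gt0.
have : \forall w \near (0 : V), A (x + w) /\
    `|g (x + w) - g x - 'd g x w| <= e / c * `|w|.
  near=> w; split.
    by near: w; apply/(nbhs0P A); exact: open_nbhs_nbhs.
  near: w; have := diff_locally dg => /eqaddoP /(_ _ ec0).
  apply: filterS => w; rewrite /= !fctE /= (addrC w).
  by rewrite opprD addrA.
move=> /nbhs_normP[d /= d0 dP].
have {}dP w : `|w| < d -> A (x + w) /\
    `|g (x + w) - g x - 'd g x w| <= e / c * `|w|.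
  by move=> wd; apply: dP; rewrite /= sub0r normrN.
near=> h.
have h0 : 0 < h by near: h; exact: nbhs_right_gt.
have hd : h * c < d.
  rewrite -ltr_pdivlMr//; near: h; apply: nbhs_right_lt.
  by rewrite divr_gt0.
(* The boolean switches the increment h v on or off, so that one bound serves both endpoints of the
   difference. *)
have small (s : R) (b : bool) : 0 <= s <= h ->
    `|s *: u + b%:R *: (h *: v)| <= h * (`|u| + `|v|).
  move=> /andP[s0 sh]; rewrite (le_trans (ler_normD _ _))// mulrDr lerD//.
    by rewrite normrZ ger0_norm// ler_wpM2r.
  by case: b; rewrite ?scale1r ?scale0r ?normr0 ?normrZ ?(gtr0_norm h0)//
    mulr_ge0// ltW.
have small' (s : R) (b : bool) : 0 <= s <= h -> `|s *: u + b%:R *: (h *: v)| < d.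
  move=> /(small s b) /le_lt_trans; apply.
  rewrite (le_lt_trans _ hd)// ler_wpM2l ?(ltW h0)//.
  by rewrite /c; have := normr_ge0 u; lra.
pose phi (s : R) := f (x + h *: v + s *: u) - f (x + s *: u).
have dphi s : 0 <= s <= h ->
    is_derive s 1 phi (g (x + h *: v + s *: u) - g (x + s *: u)).
  move=> sh; apply: is_deriveB; apply: derive_along_line; apply: df.
    by have [+ _] := dP _ (small' s true sh);
      rewrite scale1r addrCA addrC -addrA addrCA addrA.
  by have [+ _] := dP _ (small' s false sh); rewrite scale0r addr0.
have [xi xih] : exists2 xi, xi \in `[0, h]%R &
   phi h - phi 0 = (g (x + h *: v + xi *: u) - g (x + xi *: u)) * (h - 0).
  apply: (@MVT_segment _ phi (fun s => g (x + h *: v + s *: u) - g (x + s *: u))).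
  - exact: ltW.
  - by move=> s; rewrite in_itv /= => /andP[s0 sh]; apply: dphi; rewrite !ltW.
  - apply: derivable_within_continuous => s; rewrite in_itv /=.
    by move=> /dphi [dp _]; exact: dp.
rewrite in_itv /= in xih.
have -> : phi h - phi 0 =
    f (x + h *: u + h *: v) - f (x + h *: u) - f (x + h *: v) + f x.
  by rewrite /phi !scale0r !addr0 opprB addrA (addrAC x) (addrAC _ (f x)).
rewrite subr0 => ->.
have [_ ] := dP _ (small' _ true xih); have [_ ] := dP _ (small' _ false xih).
rewrite scale1r scale0r addr0 [in x + (_ + _)](addrC (xi *: u)) addrA.
have -> : 'D_v g x = 'd g x v by rewrite deriveE.
rewrite linearD [X in 'd g x (xi *: u) + X]linearZ /=.
have n0 := small _ false xih; have n1 := small _ true xih.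
rewrite scale0r addr0 in n0; rewrite scale1r in n1.
have n0' : `|xi *: u| <= h * `|u|.
  by move: xih => /andP[? ?]; rewrite normrZ ger0_norm// ler_wpM2r.
set g1 := g (_ + _ + _); set g0 := g (x + _); set gx := g x.
set d0' := 'd g x (xi *: u); set dv := 'd g x v.
move=> b0 b1.
(* Both values of [g] are expanded at [x]: the increment [d0'] along u cancels, and what remains is
   a difference of two first-order remainders, bounded by [b1] and [b0]. *)
have -> : (g1 - g0) * h - h ^+ 2 * dv =
   h * ((g1 - gx - (d0' + h *: dv)) - (g0 - gx - d0')).
  by rewrite /GRing.scale /=; ring.
rewrite normrM gtr0_norm// expr2 [e * _]mulrCA ler_wpM2l ?(ltW h0)//.
apply: (le_trans (ler_normB _ _)).
apply: (le_trans (lerD b1 b0)).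
rewrite -mulrDr mulrAC ler_pdivrMr// -mulrA ler_wpM2l ?(ltW e0)//.
rewrite (le_trans (lerD n1 n0'))//.
rewrite -mulrDr ler_wpM2l ?(ltW h0)// /c; lra.
Unshelve. all: by end_near. Qed.

(** The second difference is symmetric in u and v. Divided by h^2, it lies within e/2 of each mixed
    derivative for small h > 0, so the two differ by at most e, for every e > 0. *)
Lemma derive_commute A f x u v : open A -> A x ->
  (forall y, A y -> differentiable f y) ->
  differentiable (fun y => 'D_u f y) x -> differentiable (fun y => 'D_v f y) x ->
  'D_v (fun y => 'D_u f y) x = 'D_u (fun y => 'D_v f y) x.
Proof.
move=> oA Ax df du dv; set a := LHS; set b := RHS.
apply/eqP; rewrite -subr_eq0 -normr_le0; apply/ler_addgt0Pl => e e0; rewrite addr0.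
have e20 : 0 < e / 2 by rewrite divr_gt0.
have Pu := second_difference v oA Ax df du e20.
have Pv := second_difference u oA Ax df dv e20.
have [h [h0 [Hu Hv]]] := filter_ex (filterI (nbhs_right_gt 0) (filterI Pu Pv)).
rewrite -/a in Hu; rewrite -/b (addrAC x (h *: v)) in Hv.
have h20 : 0 < h ^+ 2 by rewrite exprn_gt0.
rewrite -(ler_pM2r h20) -{1}(gtr0_norm h20) -normrM.
set f1 := f (x + h *: u + h *: v) in Hu Hv.
set f2 := f (x + h *: u) in Hu Hv; set f3 := f (x + h *: v) in Hu Hv.
have -> : (a - b) * h ^+ 2 =
   (f1 - f3 - f2 + f x - h ^+ 2 * b) - (f1 - f2 - f3 + f x - h ^+ 2 * a).
  by ring.
rewrite (le_trans (ler_normB _ _))// (le_trans (lerD Hv Hu))//.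
by rewrite -mulrDl -splitr.
Qed.

End DirectionalCalculus.

(** * Smooth scalar functions: closure properties and rules of derivation *)

Section FiniteSmoothness.
Context {R : realType} {V : normedModType R}.
Variable A : set V.
Hypothesis oA : open A.
Implicit Types (f g : V -> R) (v : V) (k : nat).

(* Unlike [smooth_on], counts orders of differentiation, which is what allows the
   closure under products and inverses to be proved by induction. *)
Fixpoint differentiable_times k f : Prop :=
  (forall x, A x -> differentiable f x) /\
  if k is k'.+1 then forall v, differentiable_times k' (fun x => 'D_v f x)
  else True.

Definition smooth f : Prop := forall k, differentiable_times k f.

Lemma smooth_onW f : smooth_on A f -> smooth f.
Proof.
move=> + k; elim: k f => [|k IH] f sf /=; first by split=> // x /(sf [::]).
split=> [x /(sf [::])//|v]; apply: IH => vs x Ax.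
by have := sf (rcons vs v) x Ax; rewrite /iterated_derive foldr_rcons.
Qed.

Lemma smooth_differentiable f x : smooth f -> A x -> differentiable f x.
Proof. by move=> /(_ 0) [+ _]; apply. Qed.

Lemma smooth_derivable f x v : smooth f -> A x -> derivable f x v.
Proof. by move=> sf Ax; apply/diff_derivable/smooth_differentiable. Qed.

Lemma smooth_derive f v : smooth f -> smooth (fun x => 'D_v f x).
Proof. by move=> sf k; have [_] := sf k.+1; apply. Qed.

(** The product and quotient rules hold only at points of [A]; this lemma lets the inductions below
    replace a derivative by its formula. *)
Lemma differentiable_times_eq k f g : {in A, f =1 g} ->
  differentiable_times k f -> differentiable_times k g.
Proof.
elim: k f g => [|k IH] f g fg /= [df Df].
  by split=> // x Ax; exact: (open_eq_differentiable oA Ax fg (df _ Ax)).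
split=> [x Ax|v]; first exact: (open_eq_differentiable oA Ax fg (df _ Ax)).
by apply: IH (Df v) => x; rewrite inE => Ax; exact: (open_eq_derive v oA Ax fg).
Qed.

Lemma smooth_eq f g : {in A, f =1 g} -> smooth f -> smooth g.
Proof. by move=> fg sf k; exact: differentiable_times_eq (sf k). Qed.

Lemma differentiable_timesW k f :
  differentiable_times k.+1 f -> differentiable_times k f.
Proof.
elim: k f => [|k IH] f [df Df]; split=> // v; apply: IH; exact: Df.
Qed.

Lemma differentiable_times_cst k (c : R) : differentiable_times k (fun=> c).
Proof.
elim: k c => [|k IH] c; split=> // v.
by apply: differentiable_times_eq (IH 0) => x _; rewrite derive_cst.
Qed.

Lemma differentiable_timesD k f g : differentiable_times k f ->
  differentiable_times k g -> differentiable_times k (fun x => f x + g x).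
Proof.
elim: k f g => [|k IH] f g /= [df Df] [dg Dg].
  by split=> // x Ax; apply: differentiableD; [exact: df|exact: dg].
split=> [x Ax|v]; first by apply: differentiableD; [exact: df|exact: dg].
apply: differentiable_times_eq (IH _ _ (Df v) (Dg v)) => x; rewrite inE => Ax.
by rewrite deriveD //; apply: diff_derivable; [exact: df|exact: dg].
Qed.

Lemma differentiable_timesM k f g : differentiable_times k f ->
  differentiable_times k g -> differentiable_times k (fun x => f x * g x).
Proof.
elim: k f g => [|k IH] f g.
  move=> [df _] [dg _].
  by split=> // x Ax; apply: differentiableM; [exact: df|exact: dg].
move=> sf sg; have := sf; have := sg => /= -[dg Dg] [df Df].
split=> [x Ax|v]; first by apply: differentiableM; [exact: df|exact: dg].
have sf' := differentiable_timesW sf; have sg' := differentiable_timesW sg.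
apply: differentiable_times_eq
  (differentiable_timesD (IH _ _ sf' (Dg v)) (IH _ _ sg' (Df v))) => x.
rewrite inE => Ax; rewrite deriveM //; apply: diff_derivable; [exact: df|exact: dg].
Qed.

(** Induction through D(1/f) = -(1/f)^2 Df, whose right side involves 1/f only to the order already
    treated. *)
Lemma differentiable_timesV k f : (forall x, A x -> f x != 0) ->
  differentiable_times k f -> differentiable_times k (fun x => (f x)^-1).
Proof.
move=> f0; elim: k => [|k IH].
  by move=> [df _]; split=> // x Ax; apply: differentiableV; [exact: df|exact: f0].
move=> sf; have /= [df Df] := sf.
split=> [x Ax|v]; first by apply: differentiableV; [exact: df|exact: f0].
have sV := IH (differentiable_timesW sf).
apply: differentiable_times_eq (differentiable_timesM
  (differentiable_timesM (differentiable_times_cst k (-1))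
    (differentiable_timesM sV sV)) (Df v)) => x; rewrite inE => Ax.
rewrite deriveV; [|exact: f0|exact/diff_derivable/df].
by rewrite /GRing.scale /= mulN1r -invfM -expr2.
Qed.

Lemma smooth_cst (c : R) : smooth (fun=> c).
Proof. by move=> k; exact: differentiable_times_cst. Qed.

Lemma smoothD f g : smooth f -> smooth g -> smooth (fun x => f x + g x).
Proof. by move=> sf sg k; exact: differentiable_timesD. Qed.

Lemma smoothM f g : smooth f -> smooth g -> smooth (fun x => f x * g x).
Proof. by move=> sf sg k; exact: differentiable_timesM. Qed.

Lemma smoothV f : (forall x, A x -> f x != 0) -> smooth f ->
  smooth (fun x => (f x)^-1).
Proof. by move=> f0 sf k; exact: differentiable_timesV. Qed.

Lemma smoothN f : smooth f -> smooth (fun x => - f x).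
Proof.
move=> sf; apply: smooth_eq (smoothM (smooth_cst (-1)) sf) => x _.
by rewrite mulN1r.
Qed.

Lemma smoothB f g : smooth f -> smooth g -> smooth (fun x => f x - g x).
Proof. by move=> sf sg; apply: smoothD => //; exact: smoothN. Qed.

Lemma smooth_sum (I : Type) (r : seq I) (P : pred I) (F : I -> V -> R) :
  (forall i, smooth (F i)) -> smooth (fun x => \sum_(i <- r | P i) F i x).
Proof.
move=> sF; elim: r => [|i r IH].
  by apply: smooth_eq (smooth_cst 0) => x _; rewrite big_nil.
case Pi : (P i).
  by apply: smooth_eq (smoothD (sF i) IH) => x _; rewrite big_cons Pi.
by apply: smooth_eq IH => x _; rewrite big_cons Pi.
Qed.

Lemma smooth_prod (I : Type) (r : seq I) (P : pred I) (F : I -> V -> R) :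
  (forall i, smooth (F i)) -> smooth (fun x => \prod_(i <- r | P i) F i x).
Proof.
move=> sF; elim: r => [|i r IH].
  by apply: smooth_eq (smooth_cst 1) => x _; rewrite big_nil.
case Pi : (P i).
  by apply: smooth_eq (smoothM (sF i) IH) => x _; rewrite big_cons Pi.
by apply: smooth_eq IH => x _; rewrite big_cons Pi.
Qed.

Lemma smooth_linear (L : {linear V -> R}) : continuous L -> smooth L.
Proof.
move=> cL; have dL x : differentiable L x by exact: linear_differentiable.
case=> [|k]; first by [].
split=> // v; apply: differentiable_times_eq (differentiable_times_cst k (L v)) => x _.
by rewrite deriveE// diff_lin.
Qed.

Lemma smooth_det m (M : V -> 'M[R]_m) :
  (forall i j, smooth (fun x => M x i j)) -> smooth (fun x => \det (M x)).
Proof.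
move=> sM; apply: smooth_sum => s; apply: smoothM; first exact: smooth_cst.
exact: smooth_prod.
Qed.

(** Cramer's formula: each entry of the inverse is a cofactor, polynomial in the entries of [M],
    divided by the determinant. *)
Lemma smooth_invmx m (M : V -> 'M[R]_m) i j :
  (forall x, A x -> M x \in unitmx) ->
  (forall i j, smooth (fun x => M x i j)) -> smooth (fun x => invmx (M x) i j).
Proof.
move=> uM sM.
have sC : smooth (fun x => cofactor (M x) j i).
  apply: smoothM; first exact: smooth_cst.
  apply: smooth_det => k l.
  by apply: smooth_eq (sM (lift j k) (lift i l)) => x _; rewrite !mxE.
have sV : smooth (fun x => (\det (M x))^-1).
  apply: smoothV; last exact: smooth_det.
  by move=> x /uM; rewrite unitmxE unitfE.
apply: smooth_eq (smoothM sV sC) => x; rewrite inE => /uM uMx.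
by rewrite /invmx uMx !mxE.
Qed.

Lemma smooth_deriveD f g x v : smooth f -> smooth g -> A x ->
  'D_v (fun x => f x + g x) x = 'D_v f x + 'D_v g x.
Proof. by move=> sf sg Ax; rewrite deriveD//; exact: smooth_derivable. Qed.

Lemma smooth_deriveM f g x v : smooth f -> smooth g -> A x ->
  'D_v (fun x => f x * g x) x = 'D_v f x * g x + f x * 'D_v g x.
Proof.
move=> sf sg Ax; rewrite deriveM; [|exact: smooth_derivable|exact: smooth_derivable].
by rewrite addrC [_ *: 'D_v f x]mulrC.
Qed.

Lemma smooth_deriveZ (c : R) f x v : smooth f -> A x ->
  'D_v (fun x => c * f x) x = c * 'D_v f x.
Proof.
move=> sf Ax; rewrite smooth_deriveM//; last exact: smooth_cst.
by rewrite derive_cst mul0r add0r.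
Qed.

Lemma smooth_deriveB f g x v : smooth f -> smooth g -> A x ->
  'D_v (fun x => f x - g x) x = 'D_v f x - 'D_v g x.
Proof. by move=> sf sg Ax; rewrite deriveB//; exact: smooth_derivable. Qed.

Lemma smooth_derive_sum (I : Type) (r : seq I) (F : I -> V -> R) x v :
  (forall i, smooth (F i)) -> A x ->
  'D_v (fun x => \sum_(i <- r) F i x) x = \sum_(i <- r) 'D_v (F i) x.
Proof.
move=> sF Ax; elim: r => [|i r IH].
  rewrite big_nil (_ : (fun y => _) = cst 0) ?derive_cst//.
  by apply/funext => y; rewrite big_nil.
rewrite (_ : (fun y => _) = fun y => F i y + \sum_(j <- r) F j y); last first.
  by apply/funext => y; rewrite big_cons.
by rewrite smooth_deriveD ?big_cons ?IH//; exact: smooth_sum.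
Qed.

End FiniteSmoothness.

(** * Fiber coordinates and fiber dilations as linear maps *)

Section FiberCoordinates.
Context {R : realType} {n : nat}.
Implicit Types (z v : coords R n) (i j : 'I_n).

Definition fiber_coord i z : R := z.2 0 i.

Fact fiber_coord_is_linear i : linear (fiber_coord i).
Proof. by move=> c z v; rewrite /fiber_coord /= !mxE. Qed.

HB.instance Definition _ i := GRing.isLinear.Build R (coords R n) R _
  (fiber_coord i) (fiber_coord_is_linear i).

Lemma continuous_fiber_coord i : continuous (fiber_coord i).
Proof.
move=> z; apply: (@continuous_comp _ _ _ snd (fun y : 'rV[R]_n => y 0 i)).
  exact: cvg_snd.
exact: coord_continuous.
Qed.

Lemma derive_fiber_coord i v z : 'D_v (fun z => z.2 0 i) z = v.2 0 i.
Proof.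
rewrite -/(fiber_coord i) deriveE.
  by rewrite diff_lin//; exact: continuous_fiber_coord.
by apply: linear_differentiable; exact: continuous_fiber_coord.
Qed.

Lemma smooth_fiber_coord (A : set (coords R n)) i : open A ->
  smooth A (fun z => z.2 0 i).
Proof. by move=> oA; exact: (smooth_linear oA (@continuous_fiber_coord i)). Qed.

(** Making the dilation a linear map lets [derive_comp_linear] turn homogeneity of a function into
    homogeneity of its derivatives. *)
Definition fiber_scale (t : R) z : coords R n := (z.1, t *: z.2).

Fact fiber_scale_is_linear t : linear (fiber_scale t).
Proof.
move=> c z v; rewrite [RHS]surjective_pairing /fiber_scale /=; congr (_, _).
by rewrite scalerDr !scalerA mulrC.
Qed.

HB.instance Definition _ t := GRing.isLinear.Build R (coords R n) (coords R n) _
  (fiber_scale t) (fiber_scale_is_linear t).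

End FiberCoordinates.

(** * Homogeneity of derivatives and Euler's relation *)

Section Homogeneity.
Context {R : realType} {n : nat}.
Variable A : set (coords R n).
Hypothesis oA : open A.
Hypothesis coneA : forall z t, A z -> 0 < t -> A (fiber_scale t z).
Implicit Types (f g : coords R n -> R) (z : coords R n) (i j : 'I_n) (k : nat).

(** The dilation fixes the directions of the base coordinates, so differentiating along them keeps
    the degree. *)
Lemma homogeneous_dx k i f : smooth A f -> homogeneous_on A k f ->
  homogeneous_on A k (dx i f).
Proof.
move=> sf hf z t Az t0; rewrite /dx -[(z.1, _)]/(fiber_scale t z).
have -> : (delta_mx 0 i, 0) = fiber_scale t (delta_mx 0 i, 0 : 'rV[R]_n).
  by rewrite /fiber_scale /= scaler0.
rewrite -derive_comp_linear [in RHS]/fiber_scale /= scaler0.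
rewrite -(smooth_deriveZ oA)//; apply: (open_eq_derive _ oA Az) => y.
by rewrite inE => Ay; exact: hf.
Qed.

(** The dilation multiplies a fiber direction by t, and cancelling this factor lowers the degree by
    one. *)
Lemma homogeneous_dy k i f : smooth A f -> homogeneous_on A k.+1 f ->
  homogeneous_on A k (dy i f).
Proof.
move=> sf hf z t Az t0; rewrite /dy -[(z.1, _)]/(fiber_scale t z).
apply: (mulfI (lt0r_neq0 t0)).
have sE : fiber_scale t (0, delta_mx 0 i) =
    t *: (0, delta_mx 0 i) :> coords R n.
  by rewrite [RHS]surjective_pairing /fiber_scale /= scaler0.
have dft : differentiable f (fiber_scale t z).
  by apply: smooth_differentiable sf _; exact: coneA.
rewrite deriveE// -[LHS]linearZ -sE -deriveE// -derive_comp_linear.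
rewrite mulrA -exprnP -exprS -(smooth_deriveZ oA)//.
by apply: (open_eq_derive _ oA Az) => y; rewrite inE => Ay; exact: hf.
Qed.

(** The left side is the derivative of f in the direction (0, y). Along the line z + s (0, y) with s
    > -1, homogeneity gives f(z) (1 + s)^k, whose derivative at s = 0 is k f(z). *)
Lemma euler_homogeneous k f z : smooth A f -> homogeneous_on A k f -> A z ->
  \sum_j dy j f z * z.2 0 j = k%:R * f z.
Proof.
move=> sf hf Az; have df := smooth_differentiable sf Az.
pose y : coords R n := (0, z.2).
have -> : \sum_j dy j f z * z.2 0 j = 'D_y f z.
  have -> : y = \sum_j z.2 0 j *: (0, delta_mx 0 j) :> coords R n.
    rewrite [RHS]surjective_pairing raddf_sum (raddf_sum snd) /=; congr pair.
      by rewrite big1// => j _; rewrite scaler0.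
    by rewrite {1}[z.2]row_sum_delta.
  rewrite deriveE// linear_sum; apply: eq_bigr => j _.
  by rewrite linearZ /dy deriveE// mulrC.
have zE : z = z + 0 *: y by rewrite scale0r addr0.
rewrite [X in 'D_y f X]zE.
have /derive_along_line [_ <-] : differentiable f (z + 0 *: y) by rewrite -zE.
have o1 : open [set s : R | -1 < s] by exact: open_gt.
rewrite (@open_eq_derive _ _ _ _ (fun s : R => f z * (1 + s) ^+ k) _ _ o1) /=;
  last 2 first.
- by rewrite /= oppr_lt0.
- move=> s; rewrite inE /= => s1.
  rewrite mulrC exprnP -hf//; last by rewrite -ltrBlDl sub0r.
  by congr (f _); rewrite [LHS]surjective_pairing /= scaler0 addr0 scalerDl scale1r.
have d1 : is_derive (0 : R) (1 : R) (cst 1 + id : R -> R) 1.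
  by apply: is_derive_eq; rewrite add0r.
rewrite (_ : (fun s : R => _) = f z *: (cst 1 + id : R -> R) ^+ k); last first.
  by apply/funext => s; rewrite !fctE.
have [_ ->] := is_deriveZ (f z) (is_deriveX k d1).
by rewrite !fctE addr0 expr1n mulr1 /GRing.scale /= mulr1 mulrC.
Qed.

End Homogeneity.

(** * Third fiber derivatives of products with a fiber coordinate *)

Section FiberDerivatives.
Context {R : realType} {n : nat}.
Variable A : set (coords R n).
Hypothesis oA : open A.
Hypothesis coneA : forall z t, A z -> 0 < t -> A (fiber_scale t z).
Hypothesis slitA : forall z, A z -> z.2 != 0.
Implicit Types (z : coords R n) (i j k l m r : 'I_n) (f : coords R n -> R).

Lemma fiber_coord_neq0 z : A z -> exists i, z.2 0 i != 0.
Proof.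
move=> /slitA; apply: contra_neqP => /forallNP z0; apply/rowP => i.
by rewrite mxE; apply/eqP/negPn/negP; exact: z0.
Qed.

Lemma dy_fiber_coord i j z : dy j (fun z => z.2 0 i) z = (i == j)%:R.
Proof. by rewrite /dy derive_fiber_coord mxE eqxx. Qed.

Lemma dy_mul_fiber_coord f i j z : smooth A f -> A z ->
  dy j (fun z => f z * z.2 0 i) z = dy j f z * z.2 0 i + f z * (i == j)%:R.
Proof.
move=> sf Az; rewrite -(dy_fiber_coord i j z).
by rewrite /dy (@smooth_deriveM _ _ A)//; exact: smooth_fiber_coord.
Qed.

Lemma dx_mul_fiber_coord f i j z : smooth A f -> A z ->
  dx j (fun z => f z * z.2 0 i) z = dx j f z * z.2 0 i.
Proof.
move=> sf Az; rewrite /dx (@smooth_deriveM _ _ A)//; last exact: smooth_fiber_coord.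
by rewrite derive_fiber_coord mxE mulr0 addr0.
Qed.

(** Leibniz rule in which at most one derivative can fall on the linear factor y^i, where it leaves
    a Kronecker delta. *)
Lemma dy3_mul_fiber_coord f i j k l z : smooth A f -> A z ->
  dy j (dy k (dy l (fun z => f z * z.2 0 i))) z =
  dy j (dy k (dy l f)) z * z.2 0 i + dy k (dy l f) z * (i == j)%:R
  + dy j (dy l f) z * (i == k)%:R + dy j (dy k f) z * (i == l)%:R.
Proof.
move=> sf Az.
have sy (g : coords R n -> R) p : smooth A g -> smooth A (dy p g).
  by move=> sg; exact: smooth_derive.
have sc (b : bool) : smooth A (fun=> b%:R) by exact: smooth_cst.
have E1 : {in A, dy l (fun z => f z * z.2 0 i) =1
    fun z => dy l f z * z.2 0 i + f z * (i == l)%:R}.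
  by move=> y; rewrite inE => Ay; exact: dy_mul_fiber_coord.
have E2 : {in A, dy k (dy l (fun z => f z * z.2 0 i)) =1
    fun z => (dy k (dy l f) z * z.2 0 i + dy l f z * (i == k)%:R)
             + (i == l)%:R * dy k f z}.
  move=> y; rewrite inE => Ay; rewrite {1}/dy (open_eq_derive _ oA Ay E1).
  rewrite (@smooth_deriveD _ _ A)//; last 2 first.
  - by apply: smoothM => //; [exact: sy|exact: smooth_fiber_coord].
  - exact: smoothM.
  rewrite -[X in X + _]/(dy k (fun z => dy l f z * z.2 0 i) y).
  rewrite dy_mul_fiber_coord//; last exact: sy.
  rewrite (@smooth_deriveM _ _ A)//.
  by rewrite derive_cst mulr0 addr0 [(i == l)%:R * _]mulrC.
rewrite {1}/dy (open_eq_derive _ oA Az E2).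
have s1 : smooth A (fun z => dy k (dy l f) z * z.2 0 i).
  by apply: smoothM => //; [exact: (sy _ k (sy _ l sf))|exact: smooth_fiber_coord].
have s2 : smooth A (fun z => dy l f z * (i == k)%:R).
  by apply: smoothM => //; exact: sy.
rewrite (@smooth_deriveD _ _ A) ?(@smooth_deriveD _ _ A)//; last 2 first.
- exact: smoothD.
- by apply: smoothM => //; exact: sy.
rewrite -[X in X + _ + _]/(dy j (fun z => dy k (dy l f) z * z.2 0 i) z).
rewrite dy_mul_fiber_coord//; last exact: (sy _ k (sy _ l sf)).
rewrite (@smooth_deriveM _ _ A)// ?derive_cst ?mulr0 ?addr0; last exact: sy.
rewrite (smooth_deriveZ oA)//; last exact: sy.
by rewrite [(i == l)%:R * _]mulrC.
Qed.
(** This is the shape of the Douglas tensor, with [g] a spray coefficient, [f] the fiber divergence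
    of the spray and [c] equal to 1/(n+1). The values [a1], [a2], [a3] are later supplied by the
    traced Berwald curvature. *)
Lemma dy3_sub_radial f g (c a1 a2 a3 : R) i j k l z : smooth A f -> smooth A g -> A z ->
  c * dy k (dy l f) z = a1 -> c * dy j (dy l f) z = a2 -> c * dy j (dy k f) z = a3 ->
  dy j (dy k (dy l (fun z => g z - c * f z * z.2 0 i))) z =
  dy j (dy k (dy l g)) z - (c * dy j (dy k (dy l f)) z * z.2 0 i
    + a1 * (i == j)%:R + a2 * (i == k)%:R + a3 * (i == l)%:R).
Proof.
move=> sf sg Az <- <- <-.
have sy h p : smooth A h -> smooth A (dy p h) by exact: smooth_derive.
pose fy z := f z * z.2 0 i.
have sfy : smooth A fy by apply: (smoothM oA sf); exact: smooth_fiber_coord.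
have lin h1 h2 p : smooth A h1 -> smooth A h2 ->
    {in A, dy p (fun z => h1 z - c * h2 z) =1 fun z => dy p h1 z - c * dy p h2 z}.
  move=> s1 s2 y; rewrite inE => Ay; rewrite /dy (@smooth_deriveB _ _ A)//.
    by rewrite (smooth_deriveZ oA).
  exact: (smoothM oA (smooth_cst oA c)).
have E0 : (fun z => g z - c * f z * z.2 0 i) = (fun z => g z - c * fy z).
  by apply/funext => y; rewrite -mulrA.
have E1 : {in A, dy l (fun z => g z - c * f z * z.2 0 i) =1
    fun z => dy l g z - c * dy l fy z} by rewrite E0; exact: lin.
have E2 : {in A, dy k (dy l (fun z => g z - c * f z * z.2 0 i)) =1
    fun z => dy k (dy l g) z - c * dy k (dy l fy) z}.
  move=> y Ay; have := Ay; rewrite inE => Ay'.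
  rewrite {1}/dy (open_eq_derive _ oA Ay' E1).
  by apply: lin => //; exact: sy.
rewrite {1}/dy (open_eq_derive _ oA Az E2).
rewrite [LHS]lin ?inE//; [|exact: (sy _ _ (sy _ _ sg))|exact: (sy _ _ (sy _ _ sfy))].
rewrite [X in _ - c * X](dy3_mul_fiber_coord i j k l sf Az).
apply: (congr1 (fun u => dy j (dy k (dy l g)) z - u)).
by rewrite !mulrDr !mulrA.
Qed.

End FiberDerivatives.

(** * Metric, spray and angular tensors of a Finsler metric in one chart *)

Section FinslerInChart.
Context {R : realType} {n : nat}.
Variable A : set (coords R n).
Hypothesis oA : open A.
Hypothesis coneA : forall z t, A z -> 0 < t -> A (fiber_scale t z).
Hypothesis slitA : forall z, A z -> z.2 != 0.
Variable F : coords R n -> R.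
Hypothesis sF : smooth A F.
Hypothesis homF : homogeneous_on A 1 F.
Hypothesis posF : forall z, A z -> forall w : 'rV[R]_n, w != 0 ->
  0 < \sum_i \sum_j metric F z i j * w 0 i * w 0 j.
Implicit Types (z : coords R n) (i j k l m r : 'I_n) (f : coords R n -> R).

Let E := squared F.

Lemma smooth_dy f i : smooth A f -> smooth A (dy i f).
Proof. by move=> sf; exact: smooth_derive. Qed.

Lemma smooth_dx f i : smooth A f -> smooth A (dx i f).
Proof. by move=> sf; exact: smooth_derive. Qed.

Lemma smooth_squared : smooth A E.
Proof. exact: smoothM. Qed.

Lemma homogeneous_squared : homogeneous_on A 2%N E.
Proof.
by move=> z t Az t0; rewrite /E /squared homF// exprMn.
Qed.

Let sE := smooth_squared.
Let hE := homogeneous_squared.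

Lemma metricE i j z : metric F z i j = 2^-1 * dy i (dy j E) z.
Proof. by rewrite mxE. Qed.

Lemma smooth_metric i j : smooth A (fun z => metric F z i j).
Proof.
apply: (smooth_eq oA) (smoothM oA (smooth_cst oA 2^-1)
  (smooth_dy i (smooth_dy j sE))) => z _.
by rewrite metricE.
Qed.

Lemma homogeneous_metric z t : A z -> 0 < t ->
  metric F (fiber_scale t z) = metric F z.
Proof.
move=> Az t0; apply/matrixP => i j.
have := homogeneous_dy oA coneA i (smooth_dy j sE)
  (homogeneous_dy oA coneA j sE hE) Az t0.
rewrite -[(z.1, _)]/(fiber_scale t z) expr0z mul1r => dyE.
by rewrite [LHS]metricE [RHS]metricE; exact: (congr1 (GRing.mul 2^-1) dyE).
Qed.

(** A nonzero vector in the kernel would make the positive definite quadratic form vanish. *)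
Lemma metric_unit z : A z -> metric F z \in unitmx.
Proof.
move=> Az; rewrite unitmxE unitfE; apply/det0P => -[w w0 wM].
have := posF Az w0; rewrite exchange_big /= big1 ?ltxx// => j _.
transitivity ((w *m metric F z) 0 j * w 0 j); last by rewrite wM mxE mul0r.
by rewrite mxE mulr_suml; apply: eq_bigr => i _; rewrite [w 0 i * _]mulrC.
Qed.

Lemma smooth_spray i : smooth A (spray F i).
Proof.
apply: (smoothM oA); first exact: smooth_cst.
apply: (smooth_sum oA) => l; apply: (smoothM oA).
  apply: (smooth_invmx oA) => *; [exact: metric_unit|exact: smooth_metric].
apply: (smoothB oA); last exact: smooth_dx.
apply: (smooth_sum oA) => k; apply: (smoothM oA); last exact: smooth_fiber_coord.
by apply: smooth_dx; exact: smooth_dy.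
Qed.

(** Degree count: the inverse metric has degree 0, and both terms of the bracket have degree 2, the
    first one as 1 + 1. *)
Lemma homogeneous_spray i : homogeneous_on A 2%N (spray F i).
Proof.
move=> z t Az t0; rewrite -[(z.1, _)]/(fiber_scale t z).
have invE : inv_metric F (fiber_scale t z) = inv_metric F z.
  by rewrite /inv_metric homogeneous_metric.
have dxE l : dx l E (fiber_scale t z) = t ^+ 2 * dx l E z.
  exact: (homogeneous_dx oA l sE hE Az t0).
have dxdyE k l : dx k (dy l E) (fiber_scale t z) = t * dx k (dy l E) z.
  exact: (homogeneous_dx oA k (smooth_dy l sE) (homogeneous_dy oA coneA l sE hE) Az t0).
rewrite /spray [RHS]mulrCA; apply: (congr1 (GRing.mul 4^-1)); rewrite mulr_sumr.
apply: eq_bigr => l _; rewrite invE [RHS]mulrCA.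
apply: (congr1 (GRing.mul (inv_metric F z i l))).
rewrite dxE -exprnP mulrBr mulr_sumr; apply: (congr1 (fun u => u - t ^+ 2 * dx l E z)).
by apply: eq_bigr => k _; rewrite dxdyE mxE; ring.
Qed.

Lemma metric_sym z i j : A z -> metric F z i j = metric F z j i.
Proof.
move=> Az; rewrite !metricE; apply: (congr1 (GRing.mul 2^-1)).
apply: (derive_commute oA Az); first by move=> y; exact: smooth_differentiable.
  by apply: smooth_differentiable Az; exact: smooth_dy.
by apply: smooth_differentiable Az; exact: smooth_dy.
Qed.

(** Euler's relation for the 1-homogeneous fiber derivative of F^2, after exchanging the indices of
    the metric. *)
Lemma y_lowE l z : A z -> y_low F l z = 2^-1 * dy l E z.
Proof.
move=> Az; rewrite /y_low -[dy l E z]mul1r.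
rewrite -(euler_homogeneous (smooth_dy l sE) (homogeneous_dy oA coneA l sE hE) Az).
rewrite mulr_sumr; apply: eq_bigr => j _.
by rewrite metric_sym// metricE mulrA.
Qed.

Lemma sum_y_low z : A z -> \sum_l y_low F l z * z.2 0 l = F z ^+ 2.
Proof.
move=> Az; transitivity (2^-1 * \sum_l dy l E z * z.2 0 l).
  by rewrite mulr_sumr; apply: eq_bigr => l _; rewrite y_lowE// mulrA.
by rewrite (euler_homogeneous sE hE Az) mulKf.
Qed.

Lemma squared_neq0 z : A z -> F z ^+ 2 != 0.
Proof.
move=> Az; rewrite -sum_y_low// gt_eqF//.
(* F^2 = g_ij y^i y^j is positive by definiteness applied to y itself, which is nonzero on the slit
   bundle. *)
rewrite (lt_le_trans (posF Az (slitA Az)))//.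
rewrite le_eqVlt; apply/orP; left; apply/eqP; apply: eq_bigr => i _.
by rewrite /y_low mulr_suml; apply: eq_bigr => j _; rewrite mulrAC.
Qed.

Lemma angular_sym z i j : A z -> angular F i j z = angular F j i z.
Proof. by move=> Az; rewrite /angular metric_sym// mulrAC. Qed.

Lemma sum_angular z l : A z -> \sum_m angular F l m z * z.2 0 m = 0.
Proof.
move=> Az; under eq_bigr do rewrite /angular mulrBl.
rewrite sumrB -/(y_low F l z).
under [X in _ - X]eq_bigr do rewrite -[_ * _ * z.2 0 _]mulrA.
by rewrite -mulr_sumr sum_y_low// mulrAC mulVf ?squared_neq0// mul1r subrr.
Qed.

Lemma sum_angular_mixed z i : A z ->
  \sum_r angular_mixed F i r z * z.2 0 r = 0.
Proof.
move=> Az; under eq_bigr do rewrite /angular_mixed mulrBl.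
rewrite sumrB (bigD1 i)//= eqxx mul1r big1 => [|j /negbTE]; last first.
  by rewrite eq_sym => ->; rewrite mul0r.
under [X in _ - X]eq_bigr do rewrite -[_ * _ * z.2 0 _]mulrA.
by rewrite -mulr_sumr sum_y_low// mulrAC mulVf ?squared_neq0// mul1r addr0 subrr.
Qed.

(** h^m_k differs from the identity by a multiple of y^m, which the angular metric annihilates. *)
Lemma sum_angular_mixed_angular z k l : A z ->
  \sum_m angular_mixed F m k z * angular F l m z = angular F l k z.
Proof.
move=> Az; under eq_bigr do rewrite /angular_mixed mulrBl.
rewrite sumrB (bigD1 k)//= eqxx mul1r big1 => [|j /negbTE ->]; last first.
  by rewrite mul0r.
rewrite (eq_bigr (fun m => (F z ^+ 2)^-1 * y_low F k z * (angular F l m z * z.2 0 m))).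
  by rewrite -mulr_sumr sum_angular// mulr0 subr0 addr0.
by move=> m _; ring.
Qed.

Lemma trace_angular_mixed z : A z -> \sum_m angular_mixed F m m z = n%:R - 1.
Proof.
move=> Az; rewrite /angular_mixed sumrB.
under eq_bigr do rewrite eqxx.
rewrite sumr_const card_ord; congr (_ - _).
under eq_bigr do rewrite -mulrA [z.2 0 _ * _]mulrC.
by rewrite -mulr_sumr sum_y_low// mulVf// squared_neq0.
Qed.

(** * Consequences of the assumed form of the Berwald curvature *)

Variable mu : 'I_n -> coords R n -> R.
Variable lambda : coords R n -> R.
Hypothesis hB : forall z, A z -> forall i j k l,
  berwald F i j k l z =
    (mu j z * angular F k l z + mu k z * angular F j l z
     + mu l z * angular F j k z) * z.2 0 i
    + lambda z *
      (angular_mixed F i j z * angular F k l z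
       + angular_mixed F i k z * angular F j l z
       + angular_mixed F i l z * angular F j k z).

Let G := spray F.
Let sG : forall i, smooth A (G i) := smooth_spray.
Let hG : forall i, homogeneous_on A 2%N (G i) := homogeneous_spray.

(** Second fiber derivatives of the spray have degree 0, so Euler's relation makes the contraction
    of B with y vanish; every term but this one, times y^i, is killed by h, and some y^i is nonzero.
    The factor h_kl is kept because in dimension one h is zero and the assumption leaves mu
    undetermined. *)
Lemma mu_radial_angular z k l : A z ->
  (\sum_m mu m z * z.2 0 m) * angular F k l z = 0.
Proof.
move=> Az; have [i yi0] := fiber_coord_neq0 slitA Az.
apply: (mulfI yi0); rewrite mulr0.
have hG0 : homogeneous_on A 0%N (dy k (dy l (G i))).
  apply: (homogeneous_dy oA coneA); first exact: smooth_dy.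
  exact: homogeneous_dy.
have := euler_homogeneous (smooth_dy k (smooth_dy l (sG i))) hG0 Az.
rewrite mul0r => euler; rewrite -[RHS]euler.
transitivity (z.2 0 i * (\sum_m mu m z * z.2 0 m) * angular F k l z
  + (mu k z * z.2 0 i + lambda z * angular_mixed F i k z)
    * (\sum_m angular F l m z * z.2 0 m)
  + (mu l z * z.2 0 i + lambda z * angular_mixed F i l z)
    * (\sum_m angular F k m z * z.2 0 m)
  + lambda z * angular F k l z * (\sum_m angular_mixed F i m z * z.2 0 m)).
  by rewrite !sum_angular// sum_angular_mixed// !mulr0 !addr0 mulrA.
rewrite !mulr_sumr mulr_suml -!big_split /=; apply: eq_bigr => m _.
rewrite -[dy m _ z]/(berwald F i m k l z) hB//.
by rewrite (angular_sym l m Az) (angular_sym k m Az); ring.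
Qed.

Let S z := \sum_m dy m (G m) z.

Lemma mean_berwald k l z : A z ->
  n.+1%:R^-1 * dy k (dy l S) z = lambda z * angular F k l z.
Proof.
move=> Az; apply: (canLR (mulKf _)); first by rewrite pnatr_eq0.
have E1 : {in A, dy l S =1 fun z => \sum_m dy l (dy m (G m)) z}.
  move=> y; rewrite inE => Ay; rewrite {1}/dy (smooth_derive_sum oA)//.
  by move=> m; exact: smooth_dy.
rewrite {1}/dy (open_eq_derive _ oA Az E1) (smooth_derive_sum oA)//; last first.
  by move=> m; apply: smooth_dy; exact: smooth_dy.
transitivity (mu k z * (\sum_m angular F l m z * z.2 0 m)
  + mu l z * (\sum_m angular F k m z * z.2 0 m)
  + (\sum_m mu m z * z.2 0 m) * angular F k l z
  + lambda z * ((\sum_m angular_mixed F m k z * angular F l m z)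
     + (\sum_m angular_mixed F m l z * angular F k m z)
     + (\sum_m angular_mixed F m m z) * angular F k l z)).
  (* The traced index is the innermost derivative, so the sum is literally a trace of B. The lambda
     terms contribute 1 + 1 + (n - 1) = n + 1 copies of lambda h_kl, and the mu terms vanish. *)
  rewrite (eq_bigr _ (fun m _ => hB Az m k l m)).
  move: (angular F) (angular_mixed F) => h hm.
  rewrite !mulrDr !mulr_suml !mulr_sumr -!big_split /=; apply: eq_bigr => m _; ring.
rewrite !sum_angular// mu_radial_angular// !sum_angular_mixed_angular//.
rewrite trace_angular_mixed// (angular_sym l k Az) -natr1; ring.
Qed.

(** The Kronecker parts of the three terms lambda h^i_j h_kl cancel against those produced by the
    divergence term; what is left of each h^i_j is its multiple of y^i. *)
Lemma douglas_radial i j k l z : A z -> douglas F i j k l z =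
  (mu j z * angular F k l z + mu k z * angular F j l z + mu l z * angular F j k z
   - lambda z * (F z ^+ 2)^-1 * (y_low F j z * angular F k l z
     + y_low F k z * angular F j l z + y_low F l z * angular F j k z)
   - n.+1%:R^-1 * dy j (dy k (dy l S)) z) * z.2 0 i.
Proof.
move=> Az.
have sS : smooth A S by apply: (smooth_sum oA) => m; exact: smooth_dy.
apply: etrans (dy3_sub_radial oA i sS (sG i) Az (mean_berwald k l Az)
  (mean_berwald j l Az) (mean_berwald j k Az)) _.
apply: etrans (congr1 (fun u => u - _) (hB Az i j k l)) _.
rewrite /angular_mixed.
move: (angular F) (y_low F) (dy j (dy k (dy l S))) => h yl S3.
by ring.
Qed.

Lemma douglas_smooth_radial j k l : exists2 T, smooth A T &
  forall i, {in A, douglas F i j k l =1 fun z => T z * z.2 0 i}.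
Proof.
(* Euclidean square norm of y in the chart: contracting a multiple of y with y and dividing by [N]
   recovers its coefficient. *)
pose N z := \sum_b z.2 0 b * z.2 0 b.
have N0 z : A z -> N z != 0.
  move=> Az; have [a ya] := fiber_coord_neq0 slitA Az.
  rewrite gt_eqF// /N (bigD1 a)//= ltr_wpDr//.
    by apply: sumr_ge0 => b _; rewrite -expr2 sqr_ge0.
  by rewrite -expr2 lt_neqAle sqr_ge0 eq_sym sqrf_eq0 ya.
have sy i : smooth A (fun z => z.2 0 i) by exact: smooth_fiber_coord.
have sP i : smooth A (fun z => n.+1%:R^-1 * S z * z.2 0 i).
  apply: (smoothM oA) => //; apply: (smoothM oA); first exact: smooth_cst.
  by apply: (smooth_sum oA) => m; exact: smooth_dy.
have sD i : smooth A (douglas F i j k l).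
  by do 3!apply: smooth_dy; exact: smoothB.
(* [mu] and [lambda] are not known to be smooth, so the smoothness of [T] has to
   come from that of the Douglas tensor. *)
exists (fun z => (\sum_b douglas F b j k l z * z.2 0 b) * (N z)^-1).
  apply: (smoothM oA).
    by apply: (smooth_sum oA) => b; exact: smoothM.
  apply: (smoothV oA) => //; apply: (smooth_sum oA) => b; exact: smoothM.
move=> i z; rewrite inE => Az.
under eq_bigr do rewrite douglas_radial// -mulrA.
by rewrite -mulr_sumr mulfK ?N0// -douglas_radial.
Qed.

(** Leibniz rule together with y^i_|m = 0: the terms -G^i_m and G^i_rm y^r cancel by Euler's
    relation, where lower indices on G denote fiber derivatives. *)
Lemma hderiv_douglas_radial j k l z : A z -> exists X : 'I_n -> R,
  forall i m, hderiv G (douglas F) i j k l m z = X m * z.2 0 i.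
Proof.
move=> Az.
(* The coefficients are chosen for all index triples at once, since the connection terms replace j,
   k or l by a summation index. *)
have /choice [T TP] : forall p : 'I_n * 'I_n * 'I_n, exists T, smooth A T /\
    forall i, {in A, douglas F i p.1.1 p.1.2 p.2 =1 fun z => T z * z.2 0 i}.
  by move=> p; have [T sT TE] := douglas_smooth_radial p.1.1 p.1.2 p.2; exists T.
have [sT TE] := TP (j, k, l); set t := T (j, k, l) in sT TE.
have TzE i a b c : douglas F i a b c z = T (a, b, c) z * z.2 0 i.
  by have [_ /(_ i z)] := TP (a, b, c); rewrite inE; apply.
(* This is the horizontal derivative of T_jkl treated as a tensor with three lower indices. *)
exists (fun m => dx m t z - \sum_r dy m (G r) z * dy r t z
  - \sum_r dy j (dy m (G r)) z * T (r, k, l) z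
  - \sum_r dy k (dy m (G r)) z * T (j, r, l) z
  - \sum_r dy l (dy m (G r)) z * T (j, k, r) z) => i m.
have dxE : dx m (douglas F i j k l) z = dx m t z * z.2 0 i.
  by rewrite -(dx_mul_fiber_coord oA)//; exact: (open_eq_derive _ oA Az (TE i)).
have dyE r : dy r (douglas F i j k l) z = dy r t z * z.2 0 i + t z * (i == r)%:R.
  by rewrite -(dy_mul_fiber_coord oA)//; exact: (open_eq_derive _ oA Az (TE i)).
(* The term [t z * dy m (G i) z] occurs with both signs: once from differentiating y^i along the
   fiber, once from the connection term of the upper index. *)
have -> : hderiv G (douglas F) i j k l m z = dx m t z * z.2 0 i
    - ((\sum_r dy m (G r) z * dy r t z) * z.2 0 i + t z * dy m (G i) z)
    + t z * dy m (G i) z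
    - (\sum_r dy j (dy m (G r)) z * T (r, k, l) z) * z.2 0 i
    - (\sum_r dy k (dy m (G r)) z * T (j, r, l) z) * z.2 0 i
    - (\sum_r dy l (dy m (G r)) z * T (j, k, r) z) * z.2 0 i; last by ring.
rewrite /hderiv dxE !mulr_suml; congr (_ - _ + _ - _ - _ - _).
- under eq_bigr do rewrite dyE mulrDr mulrA.
  rewrite big_split /=; congr (_ + _); rewrite (bigD1 i)//= eqxx mulr1 mulrC.
  by rewrite big1 ?addr0// => r /negbTE; rewrite eq_sym => ->; rewrite !mulr0.
- rewrite -[dy m (G i) z]mul1r -(euler_homogeneous (smooth_dy m (sG i))
    (homogeneous_dy oA coneA m (sG i) (hG i)) Az) mulr_sumr.
  by apply: eq_bigr => r _; rewrite TzE mulrCA.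
- by apply: eq_bigr => r _; rewrite TzE mulrA.
- by apply: eq_bigr => r _; rewrite TzE mulrA.
- by apply: eq_bigr => r _; rewrite TzE mulrA.
Qed.

Lemma douglas_weyl i j k l z : A z ->
  \sum_r \sum_m angular_mixed F i r z * hderiv G (douglas F) r j k l m z * z.2 0 m
  = 0.
Proof.
move=> Az; have [X XE] := hderiv_douglas_radial j k l Az.
transitivity ((\sum_m X m * z.2 0 m) * \sum_r angular_mixed F i r z * z.2 0 r).
  rewrite mulr_sumr; apply: eq_bigr => r _; rewrite mulr_suml.
  by apply: eq_bigr => m _; rewrite XE; ring.
by rewrite sum_angular_mixed// mulr0.
Qed.

End FinslerInChart.

(** * From a single chart to the manifold *)

Lemma open_TM0_chart (R : realType) (n : nat) (M : manifold R n)
  (a : chart R n M) : open (TM0_chart a).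
Proof.
rewrite (_ : TM0_chart a = fst @^-1` chart_cod a `&` snd @^-1` (~` [set 0])) //.
  apply: openI; apply: open_comp.
  - by move=> z _; exact: cvg_fst.
  - exact: chart_cod_open.
  - by move=> z _; exact: cvg_snd.
  - exact/closed_openC/accessible_closed_set1/hausdorff_accessible/norm_hausdorff.
by apply/seteqP; split=> z [? /eqP].
Qed.

Unset Implicit Arguments.
Set Strict Implicit.

Theorem theorem1 (R : realType) (n : nat) (M : manifold R n)
    (F : chart R n M -> coords R n -> R)
    (mu : chart R n M -> 'I_n -> coords R n -> R)
    (lambda : chart R n M -> coords R n -> R)
    (hF : finsler_metric F)
    (hmu : covector_field_along_TM0 mu)
    (hlambda : scalar_on_TM0 lambda)
    (hmu_hom : forall a i, atlas a ->
      homogeneous_on (TM0_chart a) (- 2%:Z) (mu a i))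
    (hlambda_hom : forall a, atlas a ->
      homogeneous_on (TM0_chart a) (- 1%:Z) (lambda a))
    (hB : forall a z, atlas a -> TM0_chart a z -> forall i j k l : 'I_n,
      berwald (F a) i j k l z =
        (mu a j z * angular (F a) k l z + mu a k z * angular (F a) j l z
         + mu a l z * angular (F a) j k z) * z.2 0 i
        + lambda a z *
          (angular_mixed (F a) i j z * angular (F a) k l z
           + angular_mixed (F a) i k z * angular (F a) j l z
           + angular_mixed (F a) i l z * angular (F a) j k z)) :
  GDW F.
Proof.
move=> a z atlas_a Az i j k l.
have [_ /(_ a atlas_a) [_ sF homF posF]] := hF.
have oA : open (TM0_chart a) by exact: open_TM0_chart.
have coneA y t : TM0_chart a y -> 0 < t -> TM0_chart a (fiber_scale t y).
  by move=> [Ay y0] t0; split=> //=; rewrite scaler_eq0 negb_or y0 gt_eqF.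
have slitA y : TM0_chart a y -> y.2 != 0 by case.
have homA : homogeneous_on (TM0_chart a) 1 (F a).
  by move=> y t [Ay _] t0; exact: homF.
have posA y : TM0_chart a y -> forall w : 'rV[R]_n, w != 0 ->
    0 < \sum_i \sum_j metric (F a) y i j * w 0 i * w 0 j by exact: posF.
have hBa y (Ay : TM0_chart a y) := hB a y atlas_a Ay.
exact: (douglas_weyl oA coneA slitA (smooth_onW sF) homA posA hBa).
Qed.
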